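(* Assume $C_P$ has full row rank, let $\gamma_P=\sigma_{\min}^+(C_P)$ be its smallest nonzero singular value, and let $\widetilde C_P=C_P+\Delta C_P$. If $\|\Delta C_P\|_2<\gamma_P$, then $C_P$ and $\widetilde C_P$ have the same row rank. If $\Pi_P$ and $\widetilde\Pi_P$ are the orthogonal projectors onto $\ker C_P$ and $\ker\widetilde C_P$, respectively, then $$\|\Pi_P-\widetilde\Pi_P\|_2\le\frac{\|\Delta C_P\|_2}{\gamma_P-\|\Delta C_P\|_2}.$$ In particular, if $\|\Delta C_P\|_2\le\gamma_P/2$, then $\|\Pi_P-\widetilde\Pi_P\|_2\le 2\|\Delta C_P\|_2/\gamma_P$.
   Context: $C_P\in\mathbb C^{m_P\times n_P}$ is the exact-coefficient local residual matrix: the matrix, in fixed coordinates of the space $S_p^1(P)$ of $C^1$ piecewise polynomials of degree $\le p$ on a triangulated macro-patch $P$ ($n_P=\dim S_p^1(P)$) and fixed coordinates of the broken polynomial test space $Y_{p-2}(P)=\prod_{K\subset P}\mathbb P_{p-2}(K)$ ($m_P=\dim Y_{p-2}(P)$), of the map $v\mapsto\big(\psi\mapsto\sum_{K\subset P}[(A\nabla v,\nabla\psi)_K-\langle n_K\cdot A\nabla v,\psi\rangle_{\partial K}-\kappa^2(\eta v,\psi)_K]\big)$. $\widetilde C_P$ is its counterpart, in the same coordinates, with $A,\eta$ replaced by trianglewise polynomial approximations $A_m,\eta_m$. Only the fact that $C_P$ and $\widetilde C_P$ are complex matrices of the same size is used. $\|\cdot\|_2$ is the spectral norm; projectors are orthogonal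 with respect to the Euclidean inner product on $\mathbb C^{n_P}$. *)

(* Defs.v *)
From mathcomp Require Import all_boot all_order all_algebra.
From mathcomp Require Import spectral complex.
From mathcomp Require Import boolp classical_sets reals.

Set Implicit Arguments.
Unset Strict Implicit.
Unset Printing Implicit Defensive.

Import Order.TTheory GRing.Theory Num.Theory.
Local Open Scope classical_set_scope.
Local Open Scope ring_scope.
Local Open Scope complex_scope.
Local Open Scope sesquilinear_scope.

Definition l2norm (R : realType) (n : nat) (x : 'cV[R[i]]_n) : R :=
  Num.sqrt (\sum_(i < n) (Normc.normc (x i ord0)) ^+ 2).

(* The operator norm induced by the Euclidean norms. *)
Definition spectral_norm (R : realType) (m n : nat) (A : 'M[R[i]]_(m, n)) : R :=
  sup [set l2norm (A *m x) | x in [set x : 'cV[R[i]]_n | l2norm x <= 1]].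

(* The eigenvalues of A^* A and of A A^* differ at most by 0, so whether the
   m x m or the n x n Gram matrix is used is immaterial for nonzero s. *)
Definition nonzero_singular_value (R : realType) (m n : nat)
    (A : 'M[R[i]]_(m, n)) (s : R) : Prop :=
  0 < s /\ eigenvalue (A ^t* *m A) ((s ^+ 2)%:C).

Definition smallest_nonzero_singular_value (R : realType) (m n : nat)
    (A : 'M[R[i]]_(m, n)) (g : R) : Prop :=
  nonzero_singular_value A g /\
  forall s : R, nonzero_singular_value A s -> g <= s.

(* MathComp's kermx is the left kernel; matrices act here on column vectors. *)
Definition right_kernel (R : realType) (m n : nat) (A : 'M[R[i]]_(m, n)) :
    set 'cV[R[i]]_n :=
  [set x | A *m x = 0].

Definition orthogonal_projector_onto (R : realType) (n : nat)
    (V : set 'cV[R[i]]_n) (P : 'M[R[i]]_n) : Prop :=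
  [/\ P *m P = P, P ^t* = P & range (fun x : 'cV[R[i]]_n => P *m x) = V].

(* Main.v *)
(* Full row rank gives |C^* y| >= gamma |y|, and since |Delta^* y| <= |Delta| |y|
   the perturbed matrix satisfies |Ct^* y| >= (gamma - |Delta|) |y|; hence Ct^*
   is injective.  For the projectors, Pi kills the range of C^*, so a vector
   z = Ct^* y orthogonal to ker Ct has Pi z = Pi Delta^* y, while for z in ker Ct
   the component q = C^* y of z orthogonal to ker C satisfies
   |q|^2 = <q, z> = - <y, Delta z>.  Both estimates are bounded by
   |Delta| / (gamma - |Delta|), and Pythagoras combines them without loss. *)

Require Import Defs.
From mathcomp Require Import all_boot all_order all_algebra.
From mathcomp Require Import spectral complex.
From mathcomp Require Import boolp classical_sets reals.

Import Order.TTheory GRing.Theory Num.Theory.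
Local Open Scope ring_scope.

Section SpectralNorm.
Set Implicit Arguments.
Unset Strict Implicit.
Local Open Scope complex_scope.
Local Open Scope sesquilinear_scope.
Local Open Scope classical_set_scope.
Variable R : realType.

(** * Conjugate transposes and the Euclidean norm *)

Lemma trmxCM (m n p : nat) (A : 'M[R[i]]_(m, n)) (B : 'M[R[i]]_(n, p)) :
  (A *m B)^t* = B^t* *m A^t*.
Proof. by rewrite trmx_mul map_mxM. Qed.

Lemma trmxCD (m n : nat) (A B : 'M[R[i]]_(m, n)) : (A + B)^t* = A^t* + B^t*.
Proof. by rewrite linearD map_mxD. Qed.

Lemma normc_ge0 (z : R[i]) : 0 <= Normc.normc z.
Proof. by case: z => a b; exact: sqrtr_ge0. Qed.

Lemma l2norm_ge0 (n : nat) (x : 'cV[R[i]]_n) : 0 <= l2norm x.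
Proof. exact: sqrtr_ge0. Qed.

Lemma sqr_l2normC (n : nat) (x : 'cV[R[i]]_n) :
  (l2norm x ^+ 2)%:C = (x^t* *m x) 0 0.
Proof.
rewrite sqr_sqrtr ?sumr_ge0// => [|i _]; last exact: sqr_ge0.
rewrite rmorph_sum mxE; apply: eq_bigr => i _.
by rewrite rmorphXn !mxE mulrC -normCK.
Qed.

(** Bridge to the form [dotmx] on row vectors, through which its Cauchy-Schwarz and triangle
    inequalities carry over to columns. *)
Lemma sqrtC_dotmx_l2norm (n : nat) (x : 'cV[R[i]]_n) :
  sqrtC (dotmx (x^t*) (x^t*)) = (l2norm x)%:C.
Proof.
by rewrite dotmxE trmxCK -sqr_l2normC rmorphXn sqrCK// ler0c l2norm_ge0.
Qed.

Lemma l2norm_CauchySchwarz (n : nat) (x y : 'cV[R[i]]_n) :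
  Normc.normc ((x^t* *m y) 0 0) <= l2norm x * l2norm y.
Proof.
rewrite -lecR rmorphM /= -!sqrtC_dotmx_l2norm.
have -> : (Normc.normc ((x^t* *m y) 0 0))%:C = `|dotmx (x^t*) (y^t*)|.
  by rewrite dotmxE trmxCK.
by have [] := CauchySchwarz_sqrt (@dotmx R[i] n) (x^t*) (y^t*).
Qed.

Lemma l2normD (n : nat) (x y : 'cV[R[i]]_n) :
  l2norm (x + y) <= l2norm x + l2norm y.
Proof.
rewrite -lecR rmorphD /= -!sqrtC_dotmx_l2norm trmxCD.
by have [] := triangle_lerif (@dotmx R[i] n) (x^t*) (y^t*).
Qed.

Lemma l2norm0 (n : nat) : l2norm (0 : 'cV[R[i]]_n) = 0.
Proof.
by apply/eqP; rewrite -sqrf_eq0; apply/eqP/complexI; rewrite sqr_l2normC mulmx0 mxE.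
Qed.

Lemma l2norm_eq0 (n : nat) (x : 'cV[R[i]]_n) : l2norm x = 0 -> x = 0.
Proof.
move=> x0; have := sqr_l2normC x.
rewrite x0 expr0n rmorph0 -{2}[x]trmxCK -dotmxE => /esym/eqP.
by rewrite dnorm_eq0 => /eqP xt0; rewrite -[x]trmxCK xt0 trmx0 map_mx0.
Qed.

Lemma l2normZ (n : nat) (a : R[i]) (x : 'cV[R[i]]_n) :
  l2norm (a *: x) = Normc.normc a * l2norm x.
Proof.
apply/eqP; rewrite -(@eqrXn2 _ 2) ?mulr_ge0 ?l2norm_ge0//.
  apply/eqP/complexI; rewrite sqr_l2normC exprMn rmorphM /= sqr_l2normC.
  have -> : (a *: x)^t* = Num.conj a *: x^t*.
    by apply/matrixP => i j; rewrite !mxE rmorphM.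
  rewrite -scalemxAl -scalemxAr scalerA mxE.
  by rewrite [X in _ = X * _]rmorphXn [_ * a]mulrC -normCK.
exact: normc_ge0.
Qed.

Lemma l2normN (n : nat) (x : 'cV[R[i]]_n) : l2norm (- x) = l2norm x.
Proof. by rewrite -scaleN1r l2normZ normcN Normc.normc1 mul1r. Qed.

Lemma l2norm_pythagoras (n : nat) (x y : 'cV[R[i]]_n) : x^t* *m y = 0 ->
  l2norm (x + y) ^+ 2 = l2norm x ^+ 2 + l2norm y ^+ 2.
Proof.
move=> xy; have yx : y^t* *m x = 0.
  by rewrite -[y^t* *m x]trmxCK trmxCM trmxCK xy trmx0 map_mx0.
apply/complexI; rewrite rmorphD /= !sqr_l2normC trmxCD.
by rewrite mulmxDl !mulmxDr xy yx addr0 add0r mxE.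
Qed.

(** * The spectral norm of a matrix and of its adjoint *)

Lemma l2norm_mulmx_bounded (m n : nat) (A : 'M[R[i]]_(m, n)) :
  exists M : R, forall x : 'cV[R[i]]_n, l2norm x <= 1 -> l2norm (A *m x) <= M.
Proof.
(* The witness is the Frobenius norm of [A]; Cauchy-Schwarz is applied row by row. Such a bound is
   what makes the [sup] in [spectral_norm] a genuine upper bound. *)
exists (Num.sqrt (\sum_(i < m) l2norm ((row i A)^t*) ^+ 2)) => x x1.
apply: ler_wsqrtr; apply: ler_sum => i _.
have := l2norm_CauchySchwarz ((row i A)^t*) x.
rewrite trmxCK -row_mul mxE => h.
rewrite lerXn2r// ?nnegrE ?l2norm_ge0//; first exact: normc_ge0.
apply: le_trans h _.
by rewrite -[leRHS]mulr1 ler_wpM2l ?l2norm_ge0.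
Qed.

Lemma spectral_norm_ub (m n : nat) (A : 'M[R[i]]_(m, n)) (x : 'cV[R[i]]_n) :
  l2norm x <= 1 -> l2norm (A *m x) <= spectral_norm A.
Proof.
move=> x1; apply: sup_upper_bound; last by exists x.
split; first by exists (l2norm (A *m x)), x.
have [M hM] := l2norm_mulmx_bounded A.
by exists M => _ [y /= y1 <-]; exact: hM.
Qed.

Lemma spectral_norm_ge0 (m n : nat) (A : 'M[R[i]]_(m, n)) :
  0 <= spectral_norm A.
Proof.
apply: (@le_trans _ _ (l2norm (A *m 0))); first exact: l2norm_ge0.
by apply: spectral_norm_ub; rewrite l2norm0.
Qed.

Lemma l2norm_mulmx_le (m n : nat) (A : 'M[R[i]]_(m, n)) (x : 'cV[R[i]]_n) :
  l2norm (A *m x) <= spectral_norm A * l2norm x.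
Proof.
have [/l2norm_eq0 ->|xN0] := eqVneq (l2norm x) 0.
  by rewrite mulmx0 !l2norm0 mulr0.
have x0 : 0 < l2norm x by rewrite lt_def xN0 l2norm_ge0.
have nV : Normc.normc (l2norm x)^-1%:C = (l2norm x)^-1.
  by rewrite /= expr0n addr0 sqrtr_sqr ger0_norm// invr_ge0 ltW.
have := @spectral_norm_ub _ _ A ((l2norm x)^-1%:C *: x).
rewrite -scalemxAr !l2normZ nV mulVf// lexx => /(_ isT).
by rewrite mulrC ler_pdivrMr.
Qed.

Lemma spectral_norm_le (m n : nat) (A : 'M[R[i]]_(m, n)) (k : R) : 0 <= k ->
  (forall x, l2norm (A *m x) <= k * l2norm x) -> spectral_norm A <= k.
Proof.
move=> k0 Ak; apply: ge_sup.
  by exists (l2norm (A *m 0)), 0 => //=; rewrite l2norm0.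
move=> _ [x /= x1 <-]; apply: le_trans (Ak x) _.
by rewrite -[leRHS]mulr1 ler_wpM2l.
Qed.

(** With z = A^* y, |z|^2 = <y, A z> <= |y| |A| |z|, and a nonzero |z| cancels. *)
Lemma l2norm_trmxC_mulmx_le (m n : nat) (A : 'M[R[i]]_(m, n))
    (y : 'cV[R[i]]_m) :
  l2norm (A^t* *m y) <= spectral_norm A * l2norm y.
Proof.
set z := A^t* *m y.
have [->|zN0] := eqVneq (l2norm z) 0.
  by rewrite mulr_ge0 ?spectral_norm_ge0 ?l2norm_ge0.
have z0 : 0 < l2norm z by rewrite lt_def zN0 l2norm_ge0.
rewrite -(ler_pM2r z0) -expr2 -lecR sqr_l2normC {1}/z trmxCM trmxCK -mulmxA.
have zz0 : 0 <= (y^t* *m (A *m z)) 0 0.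
  by rewrite mulmxA -[A]trmxCK -trmxCM -sqr_l2normC ler0c sqr_ge0.
rewrite -(ger0_norm zz0) lecR.
apply: le_trans (l2norm_CauchySchwarz _ _) _.
by rewrite mulrAC mulrC ler_wpM2r ?l2norm_ge0// l2norm_mulmx_le.
Qed.

(** * Full row rank and Gram matrices *)

Lemma row_free_of_l2norm_ge (m n : nat) (B : 'M[R[i]]_(m, n)) (k : R) :
  0 < k -> (forall y, k * l2norm y <= l2norm (B^t* *m y)) -> row_free B.
Proof.
move=> k0 hB; apply: inj_row_free => v vB0.
have := hB (v^t*); rewrite -trmxCM vB0 trmx0 map_mx0 l2norm0.
rewrite pmulr_rle0// => v0.
have /l2norm_eq0 vt0 : l2norm (v^t*) = 0 by apply/eqP; rewrite eq_le v0 l2norm_ge0.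
by rewrite -[v]trmxCK vt0 trmx0 map_mx0.
Qed.

(** If v B B^* = 0, then |(v B)^*|^2 = v B B^* v^* = 0, so v B = 0 and hence v = 0. *)
Lemma gram_unitmx (m n : nat) (B : 'M[R[i]]_(m, n)) :
  row_free B -> B *m B^t* \in unitmx.
Proof.
move=> Bfree; rewrite -row_free_unit; apply: inj_row_free => v vBB0.
apply/eqP; rewrite -(mulmx_free_eq0 _ Bfree); apply/eqP.
rewrite -[v *m B]trmxCK trmxCM [X in X^t*](_ : _ = 0) ?trmx0 ?map_mx0//.
apply/l2norm_eq0/eqP; rewrite -sqrf_eq0; apply/eqP/complexI.
by rewrite sqr_l2normC trmxCM !trmxCK mulmxA -(mulmxA v) vBB0 mul0mx mxE.
Qed.

(** * Lower bound for the adjoint by the smallest singular value *)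

Section SmallestSingularValue.
Variables (m n : nat) (C : 'M[R[i]]_(m, n)) (gamma : R).
Hypothesis Cfree : row_free C.
Hypothesis gammaP : smallest_nonzero_singular_value C gamma.

Lemma smallest_singular_value_gt0 : 0 < gamma.
Proof. by have [[]] := gammaP. Qed.

(** Here a = |C^* v^*|^2, which is positive because full row rank gives v C != 0. Since v C is a
    left eigenvector of C^* C for a, the norm |C^* v^*| is a nonzero singular value. *)
Lemma gram_eigenvalue_ge (v : 'rV[R[i]]_m) (a : R[i]) :
  v *m (C *m C^t*) = a *: v -> v *m v^t* = 1%:M -> (gamma ^+ 2)%:C <= a.
Proof.
move=> vH v1; set w := C^t* *m v^t*.
have aE : a = (l2norm w ^+ 2)%:C.
  rewrite sqr_l2normC trmxCM !trmxCK mulmxA -(mulmxA v) vH.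
  by rewrite -scalemxAl v1 !mxE mulr1.
have vC0 : v *m C != 0.
  rewrite mulmx_free_eq0//; apply/eqP => v0; move: v1.
  by rewrite v0 mul0mx => /matrixP/(_ 0 0)/eqP; rewrite !mxE eq_sym oner_eq0.
have w0 : 0 < l2norm w.
  rewrite lt_def l2norm_ge0 andbT; apply: contra vC0 => /eqP/l2norm_eq0 w0.
  by rewrite -[v *m C]trmxCK trmxCM -/w w0 trmx0 map_mx0.
rewrite aE lecR lerXn2r ?nnegrE ?l2norm_ge0 ?(ltW smallest_singular_value_gt0)//.
apply: gammaP.2; split=> //; apply/eigenvalueP; exists (v *m C) => //.
by rewrite -aE mulmxA -(mulmxA v) vH scalemxAl.
Qed.

(* Diagonalise [C C^*] by a unitary matrix: full row rank makes all its
   eigenvalues nonzero, so they are squares of singular values of [C]. *)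
Lemma smallest_singular_value_le (y : 'cV[R[i]]_m) :
  gamma * l2norm y <= l2norm (C^t* *m y).
Proof.
set H := C *m C^t*; set P := spectralmx H; set d := spectral_diag H.
have Hn : H \is normalmx by apply/normalmxP; rewrite trmxCM trmxCK.
have PP : P *m P^t* = 1%:M by apply/unitarymxP; exact: spectral_unitarymx.
have HE : H = P^t* *m diag_mx d *m P.
  by rewrite {1}(orthomx_spectralP Hn) invmx_unitary ?spectral_unitarymx.
(* The rows of the unitary [P] are unit left eigenvectors of [H]. *)
have d_ge i : (gamma ^+ 2)%:C <= d 0 i.
  apply: (@gram_eigenvalue_ge (row i P)).
    rewrite -/H -row_mul HE !mulmxA PP mul1mx mul_diag_mx.
    by apply/rowP => j; rewrite !mxE.
  apply/matrixP => j k; rewrite !ord1 -dotmxE mxE.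
  by have /row_unitarymxP -> := spectral_unitarymx H; rewrite eqxx.
set u := P *m y.
have uE : l2norm u ^+ 2 = l2norm y ^+ 2.
  apply/complexI; rewrite !sqr_l2normC trmxCM mulmxA -(mulmxA (y^t*)).
  by rewrite (mulmx1C PP) mulmx1.
rewrite -(@ler_pXn2r _ 2) ?nnegrE ?mulr_ge0 ?l2norm_ge0//; last first.
  exact: ltW smallest_singular_value_gt0.
rewrite exprMn -uE -lecR sqr_l2normC rmorphM /= sqr_l2normC.
rewrite [(C^t* *m y)^t*]trmxCM trmxCK mulmxA -(mulmxA (y^t*)) -/H HE.
have -> : y^t* *m (P^t* *m diag_mx d *m P) *m y = u^t* *m diag_mx d *m u.
  by rewrite trmxCM !mulmxA.
rewrite mul_mx_diag.
(* In the eigenbasis both sides are sums with weights |u_i|^2, so [d_ge] settles each term. *)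
rewrite !mxE mulr_sumr; apply: ler_sum => i _.
move: (u) => w; rewrite !mxE [leRHS]mulrAC [leRHS]mulrC ler_wpM2r//.
by rewrite mulrC -normCK exprn_ge0.
Qed.
End SmallestSingularValue.

(** * Orthogonal projectors onto a kernel *)

Section OrthogonalProjector.
Variables (m n : nat) (B : 'M[R[i]]_(m, n)) (P : 'M[R[i]]_n).
Hypothesis P_proj : orthogonal_projector_onto (right_kernel B) P.

Lemma projector_orthogonal (x y : 'cV[R[i]]_n) :
  (P *m x)^t* *m (y - P *m y) = 0.
Proof.
have [PP Ph _] := P_proj.
by rewrite trmxCM Ph mulmxBr -!mulmxA [P *m (P *m y)]mulmxA PP subrr.
Qed.

Lemma projector_pythagoras (x : 'cV[R[i]]_n) :
  l2norm x ^+ 2 = l2norm (P *m x) ^+ 2 + l2norm (x - P *m x) ^+ 2.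
Proof.
by rewrite -l2norm_pythagoras ?projector_orthogonal// addrC subrK.
Qed.

Lemma l2norm_projector_le (x : 'cV[R[i]]_n) : l2norm (P *m x) <= l2norm x.
Proof.
rewrite -(@ler_pXn2r _ 2) ?nnegrE ?l2norm_ge0//.
by rewrite [leRHS]projector_pythagoras lerDl sqr_ge0.
Qed.

Lemma mulmx_projector_kernel : B *m P = 0.
Proof.
have [_ _ rP] := P_proj.
apply/matrixP => i j.
have : right_kernel B (P *m delta_mx j 0) by rewrite -rP; exists (delta_mx j 0).
by rewrite /right_kernel /= mulmxA -colE => /colP/(_ i); rewrite !mxE.
Qed.

Lemma projector_mulmx_adjoint : P *m B^t* = 0.
Proof.
have [_ Ph _] := P_proj.
by rewrite -[P]Ph -trmxCM mulmx_projector_kernel trmx0 map_mx0.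
Qed.

Lemma projector_compl_adjoint (x : 'cV[R[i]]_n) :
  row_free B -> exists y, x - P *m x = B^t* *m y.
Proof.
move=> /gram_unitmx Gu; have [PP _ rP] := P_proj.
pose y := invmx (B *m B^t*) *m (B *m x); exists y.
have : right_kernel B (x - B^t* *m y).
  by rewrite /right_kernel /= mulmxBr !mulmxA mulmxV// mul1mx subrr.
rewrite -rP => -[z _ zE].
have : P *m (x - B^t* *m y) = x - B^t* *m y by rewrite -zE mulmxA PP.
rewrite mulmxBr mulmxA projector_mulmx_adjoint mul0mx subr0 => ->.
by rewrite opprB addrC subrK.
Qed.
End OrthogonalProjector.

(** * Perturbation of the kernel projector *)

Section Perturbation.
Variables (m n : nat) (C Delta : 'M[R[i]]_(m, n)) (gamma : R).
Hypothesis Cfree : row_free C.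
Hypothesis gammaP : smallest_nonzero_singular_value C gamma.
Hypothesis Delta_lt : spectral_norm Delta < gamma.
Local Notation d := (spectral_norm Delta).

Lemma perturbed_adjoint_l2norm_ge (y : 'cV[R[i]]_m) :
  (gamma - d) * l2norm y <= l2norm ((C + Delta)^t* *m y).
Proof.
rewrite mulrBl lerBlDr.
apply: le_trans (smallest_singular_value_le Cfree gammaP y) _.
have -> : C^t* *m y = (C + Delta)^t* *m y + - (Delta^t* *m y).
  by rewrite trmxCD mulmxDl addrK.
apply: le_trans (l2normD _ _) _.
by rewrite l2normN lerD2l l2norm_trmxC_mulmx_le.
Qed.

Lemma perturbed_row_free : row_free (C + Delta).
Proof.
apply: (@row_free_of_l2norm_ge _ _ _ (gamma - d)); first by rewrite subr_gt0.
exact: perturbed_adjoint_l2norm_ge.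
Qed.

Variables Pi Pit : 'M[R[i]]_n.
Hypothesis Pi_proj : orthogonal_projector_onto (right_kernel C) Pi.
Hypothesis Pit_proj : orthogonal_projector_onto (right_kernel (C + Delta)) Pit.

Lemma projector_of_perturbed_compl (x : 'cV[R[i]]_n) :
  l2norm (Pi *m (x - Pit *m x)) <= d / (gamma - d) * l2norm (x - Pit *m x).
Proof.
have [y ->] := projector_compl_adjoint Pit_proj x perturbed_row_free.
have gd : 0 < gamma - d by rewrite subr_gt0.
rewrite {1}trmxCD mulmxDl mulmxDr [X in X + _]mulmxA.
rewrite (projector_mulmx_adjoint Pi_proj) mul0mx add0r.
apply: le_trans (l2norm_projector_le Pi_proj _) _.
apply: le_trans (l2norm_trmxC_mulmx_le _ _) _.
rewrite -mulrA ler_wpM2l ?spectral_norm_ge0// mulrC ler_pdivlMr// mulrC.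
exact: perturbed_adjoint_l2norm_ge.
Qed.

Lemma compl_of_perturbed_projector (x : 'cV[R[i]]_n) :
  l2norm (Pit *m x - Pi *m (Pit *m x)) <= d / (gamma - d) * l2norm (Pit *m x).
Proof.
set z := Pit *m x; set q := z - Pi *m z.
have g0 := smallest_singular_value_gt0 gammaP.
(* [z] lies in the kernel of [C + Delta]. *)
have Cz : C *m z = - (Delta *m z).
  apply/eqP; rewrite -addr_eq0 -mulmxDl mulmxA.
  by rewrite (mulmx_projector_kernel Pit_proj) mul0mx.
have [y qE] := projector_compl_adjoint Pi_proj z Cfree; rewrite -/q in qE.
have qz : (l2norm q ^+ 2)%:C = - (y^t* *m (Delta *m z)) 0 0.
  (* [q] is orthogonal to [Pi *m z]. *)
  have qq : q^t* *m q = q^t* *m z.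
    rewrite {2}/q mulmxBr -[q^t* *m (Pi *m z)]trmxCK trmxCM trmxCK.
    by rewrite (projector_orthogonal Pi_proj) trmx0 map_mx0 subr0.
  by rewrite sqr_l2normC qq qE trmxCM trmxCK -mulmxA Cz mulmxN mxE.
have q2 : l2norm q ^+ 2 <= l2norm y * (d * l2norm z).
  rewrite -(ger0_norm (sqr_ge0 (l2norm q))).
  have -> : `|l2norm q ^+ 2| = Normc.normc (l2norm q ^+ 2)%:C.
    by rewrite /= expr0n addr0 sqrtr_sqr.
  rewrite qz normcN; apply: le_trans (l2norm_CauchySchwarz _ _) _.
  by rewrite ler_wpM2l ?l2norm_ge0// l2norm_mulmx_le.
have qy := smallest_singular_value_le Cfree gammaP y; rewrite -qE in qy.
have dz0 : 0 <= d * l2norm z by rewrite mulr_ge0 ?spectral_norm_ge0 ?l2norm_ge0.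
(* Multiply [q2] by gamma, use gamma |y| <= |q| from [qy], and cancel |q|. *)
have gq : gamma * l2norm q <= d * l2norm z.
  have [->|qN0] := eqVneq (l2norm q) 0; first by rewrite mulr0.
  have q0 : 0 < l2norm q by rewrite lt_def qN0 l2norm_ge0.
  rewrite -(ler_pM2r q0) -mulrA -expr2.
  apply: (@le_trans _ _ (gamma * (l2norm y * (d * l2norm z)))).
    by rewrite ler_pM2l.
  by rewrite mulrA [leRHS]mulrC ler_wpM2r.
(* [gq] is the sharper bound with denominator gamma; it is weakened to gamma - d so that both
   components share one constant. *)
rewrite mulrAC ler_pdivlMr ?subr_gt0//; apply: le_trans gq.
by rewrite mulrC ler_wpM2r ?l2norm_ge0// gerBl spectral_norm_ge0.
Qed.

(* [Pi - Pit = Pi (1 - Pit) - (1 - Pi) Pit] has summands with orthogonal ranges,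
   applied to the two orthogonal components of [x] with respect to [Pit]. *)
Lemma projector_perturbation : spectral_norm (Pi - Pit) <= d / (gamma - d).
Proof.
have e0 : 0 <= d / (gamma - d).
  by rewrite divr_ge0 ?spectral_norm_ge0// subr_ge0 ltW.
apply: spectral_norm_le => // x.
move: (compl_of_perturbed_projector x) (projector_of_perturbed_compl x) e0.
set z := Pit *m x; move: (d / (gamma - d)) => e qe pe e0.
have -> : (Pi - Pit) *m x = Pi *m (x - z) + - (z - Pi *m z).
  by rewrite mulmxBl mulmxBr opprB addrA subrK.
rewrite -(@ler_pXn2r _ 2) ?nnegrE ?mulr_ge0 ?l2norm_ge0//.
rewrite l2norm_pythagoras; last first.
  by rewrite mulmxN (projector_orthogonal Pi_proj) oppr0.
rewrite l2normN exprMn (projector_pythagoras Pit_proj x) mulrDr -!exprMn addrC.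
by apply: lerD; rewrite lerXn2r ?nnegrE ?mulr_ge0 ?l2norm_ge0.
Qed.
End Perturbation.

End SpectralNorm.

Theorem proposition3p4 (R : realType) (m n : nat)
    (C Ct Delta : 'M[R[i]]_(m, n)) (gamma : R)
    (C_full_row_rank : row_free C)
    (gammaP : smallest_nonzero_singular_value C gamma)
    (CtE : Ct = C + Delta) :
  [/\ spectral_norm Delta < gamma -> \rank C = \rank Ct,
      forall Pi Pit : 'M[R[i]]_n,
        orthogonal_projector_onto (right_kernel C) Pi ->
        orthogonal_projector_onto (right_kernel Ct) Pit ->
        spectral_norm Delta < gamma ->
        spectral_norm (Pi - Pit) <=
          spectral_norm Delta / (gamma - spectral_norm Delta)
    & forall Pi Pit : 'M[R[i]]_n,
        orthogonal_projector_onto (right_kernel C) Pi ->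
        orthogonal_projector_onto (right_kernel Ct) Pit ->
        spectral_norm Delta <= gamma / 2 ->
        spectral_norm (Pi - Pit) <= 2 * spectral_norm Delta / gamma].
Proof.
have g0 := smallest_singular_value_gt0 gammaP.
rewrite {}CtE; split=> [dg|Pi Pit PiP PitP dg|Pi Pit PiP PitP dg].
- by rewrite (eqP C_full_row_rank) (eqP (perturbed_row_free C_full_row_rank gammaP dg)).
- exact: (projector_perturbation C_full_row_rank gammaP dg).
have dg' : spectral_norm Delta < gamma.
  by apply: le_lt_trans dg _; rewrite ltr_pdivrMr// ltr_pMr// ltr1n.
apply: le_trans (projector_perturbation C_full_row_rank gammaP dg' PiP PitP) _.
rewrite mulrAC mulrC ler_wpM2r ?spectral_norm_ge0//.
(* Writing 2 / gamma as the inverse of gamma / 2 reduces the claim to gamma / 2 <= gamma -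
   |Delta|. *)
rewrite -[2]invrK -invfM lef_pV2 ?posrE ?subr_gt0// ?mulr_gt0 ?invr_gt0 ?ltr0n//.
by rewrite lerBrDr -lerBrDl [X in X - _](splitr gamma) [2^-1 * _]mulrC addrK.
Qed.
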